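(* Let $G$ be a separable metrizable NSS group and let $X$ be a $G$-regular space. Then $X$ is compact and metrizable if and only if $C_p(X,G)$ is a TAP group with a countable network.
   Context: All spaces are Tychonoff and non-empty; topological groups are Hausdorff; $e$ is the identity of $G$. $C_p(X,G)$ is the group of continuous maps $X\to G$ with pointwise operations and the topology of pointwise convergence. $X$ is $G$-regular if for every closed $F\subseteq X$ and every $x\in X\setminus F$ there exist $f\in C_p(X,G)$ and $g\in G\setminus\{e\}$ with $f(x)=g$ and $f(F)\subseteq\{e\}$. NSS: some open neighborhood of the identity contains no nontrivial subgroup. A subset $A$ of a topological group $H$ is absolutely productive if for every injection $a:\mathbb{N}\to A$ and every $z:\mathbb{N}\to\mathbb{Z}$ the sequence $\left(\prod_{n=0}^{k}a(n)^{z(n)}\right)_{k}$ converges in $H$; $H$ is TAP if all absolutely productive subsets are finite. *)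

(* Defs.v *)
From HB Require Import structures.
From mathcomp Require Import all_boot all_order all_algebra.
From mathcomp Require Import all_classical all_reals all_analysis.
From mathcomp Require Import Rstruct Rstruct_topology.
Set Implicit Arguments. Unset Strict Implicit. Unset Printing Implicit Defensive.
Import Order.TTheory GRing.Theory Num.Theory.
Local Open Scope classical_set_scope.
Local Open Scope ring_scope.

Definition is_topological_group (G : topologicalType)
  (mul : G -> G -> G) (inv : G -> G) (e : G) : Prop :=
  [/\ (forall x y z, mul x (mul y z) = mul (mul x y) z),
      (forall x, mul e x = x /\ mul x e = x) &
      (forall x, mul (inv x) x = e /\ mul x (inv x) = e)] /\
  [/\ continuous (fun p : G * G => mul p.1 p.2),
      continuous inv &
      hausdorff_space G].

Definition is_subgroup (G : Type) (mul : G -> G -> G) (inv : G -> G) (e : G)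
  (S : set G) : Prop :=
  [/\ S e, (forall x y, S x -> S y -> S (mul x y)) & (forall x, S x -> S (inv x))].

Definition NSS (G : topologicalType) (mul : G -> G -> G) (inv : G -> G) (e : G) : Prop :=
  exists U : set G, [/\ open U, U e &
    forall S : set G, is_subgroup mul inv e S -> S `<=` U -> S = [set e]].

Definition is_metrizable (T : topologicalType) : Prop :=
  exists d : T -> T -> Rdefinitions.R,
    [/\ (forall x y, 0 <= d x y),
        (forall x y, d x y = 0 <-> x = y),
        (forall x y, d x y = d y x),
        (forall x y z, d x z <= d x y + d y z) &
        (forall U : set T, open U <->
           forall x, U x -> exists2 eps : Rdefinitions.R, 0 < eps &
             forall y, d x y < eps -> U y)].

Definition is_separable (T : topologicalType) : Prop :=
  exists S : set T, countable S /\ dense S.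

Definition tychonoff_space (T : topologicalType) : Prop :=
  completely_regular_space T /\ hausdorff_space T.

Definition G_regular (G : topologicalType) (e : G) (X : topologicalType) : Prop :=
  forall (F : set X) (x : X), closed F -> ~ F x ->
    exists (f : X -> G) (g : G),
      [/\ continuous f, g <> e, f x = g & forall y, F y -> f y = e].

Definition gpow (G : Type) (mul : G -> G -> G) (inv : G -> G) (e : G)
  (g : G) (z : int) : G :=
  match z with
  | Posz n => iter n (mul g) e
  | Negz n => iter n.+1 (mul (inv g)) e
  end.

Fixpoint partial_prod (G : Type) (mul : G -> G -> G) (inv : G -> G) (e : G)
  (a : nat -> G) (z : nat -> int) (k : nat) : G :=
  match k with
  | 0%N => gpow mul inv e (a 0%N) (z 0%N)
  | k'.+1 => mul (partial_prod mul inv e a z k') (gpow mul inv e (a k) (z k))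
  end.

(** Notions for a topological group whose carrier is a subset C of a
    topological type T (with the subspace topology). *)
Definition absolutely_productive (T : topologicalType)
  (mul : T -> T -> T) (inv : T -> T) (e : T) (C A : set T) : Prop :=
  forall (a : nat -> T) (z : nat -> int),
    injective a -> (forall n, A (a n)) ->
    exists2 l : T, C l & partial_prod mul inv e a z @ \oo --> l.

Definition is_TAP (T : topologicalType)
  (mul : T -> T -> T) (inv : T -> T) (e : T) (C : set T) : Prop :=
  forall A : set T, A `<=` C -> absolutely_productive mul inv e C A -> finite_set A.

Definition has_countable_network (T : topologicalType) (C : set T) : Prop :=
  exists N : set (set T),
    [/\ countable N, (forall A, N A -> A `<=` C) &
      forall (x : T) (U : set T), C x -> open U -> U x ->
        exists2 A, N A & A x /\ A `<=` U `&` C].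

Definition Cp (X G : topologicalType) : set {ptws X -> G} :=
  [set f : {ptws X -> G} | continuous (f : X -> G)].

Definition pw_mul (X G : topologicalType) (mul : G -> G -> G)
  (f g : {ptws X -> G}) : {ptws X -> G} := fun x => mul (f x) (g x).
Definition pw_inv (X G : topologicalType) (inv : G -> G)
  (f : {ptws X -> G}) : {ptws X -> G} := fun x => inv (f x).
Definition pw_unit (X G : topologicalType) (e : G) : {ptws X -> G} := fun _ => e.

(* Main.v *)
(** For the forward direction, let [A] be absolutely productive and infinite in
    [C_p(X,G)] with [X] compact.  Since [G] is NSS, a nontrivial element has a
    power outside a fixed neighbourhood [U] of [e], so a sequence [(a_n)] in [A]
    must satisfy [a_n(x) = e] for almost all [n], at each [x].  Thinning out,
    one gets points [w_n] with [a_n(w_n) <> e] and [a_m(w_n) = e] for [m > n],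
    clustering at a point where all the [a_n] are trivial; exponents chosen one
    at a time then keep the infinite product away from [e] at every [w_n],
    although it equals [e] at the cluster point.  The network consists of the
    sets [{f | f(K_i) <= V_i, i <= n}] for [K_i], [V_i] in countable bases.

    Conversely, a countable network of [C_p(X,G)] induces one on [X].  If [X] is
    not compact, regularity and the network give a locally finite sequence of
    nonempty open sets; functions supported in them form an infinite absolutely
    productive set.  Finally the network provides countably many continuous maps
    [h_n : X -> G] separating points, and the metric
    [sup_n min (1/(n+1), rho (h_n x, h_n y))] is compatible with the compact
    topology of [X]. *)
Require Import Defs.
From mathcomp Require Import all_boot all_order all_algebra.
From mathcomp Require Import all_classical all_reals all_analysis.
From mathcomp Require Import Rstruct Rstruct_topology lra.
Import Order.TTheory GRing.Theory Num.Theory.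
Local Open Scope classical_set_scope.
Local Open Scope ring_scope.

Local Notation R := Rdefinitions.R.

(** * Pointwise convergence *)

Lemma cvg_ptws (X : Type) (G : topologicalType) (F : set_system {ptws X -> G})
    (f : {ptws X -> G}) : Filter F ->
  (forall x, (fun g : {ptws X -> G} => g x) @ F --> f x) -> F --> f.
Proof.
move=> FF h; apply/cvg_sup => x U [V [[W oW <-] Wf WU]].
apply: (filterS WU); apply: h; exact: open_nbhs_nbhs.
Qed.

Lemma ptws_eval_cvg {X G : topologicalType} (f : {ptws X -> G}) (x : X) :
  (fun g : {ptws X -> G} => g x) @ f --> f x.
Proof. exact: (@proj_continuous X (fun _ => G) x f). Qed.

(** * Metrics, countable bases and the network of the function space *)

Definition compatible_metric (T : topologicalType) (d : T -> T -> R) : Prop :=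
  [/\ (forall x y, 0 <= d x y),
      (forall x y, d x y = 0 <-> x = y),
      (forall x y, d x y = d y x),
      (forall x y z, d x z <= d x y + d y z) &
      (forall U : set T, open U <->
         forall x, U x -> exists2 eps : R, 0 < eps &
           forall y, d x y < eps -> U y)].

Lemma open_metric_ball (T : topologicalType) (d : T -> T -> R) x r :
  compatible_metric T d -> open [set y | d x y < r].
Proof.
move=> [_ _ _ dT dO]; apply/dO => y /= xyr; exists (r - d x y) => [|z yz].
  by rewrite subr_gt0.
by apply: le_lt_trans (dT x y z) _; lra.
Qed.

Lemma nbhs_metric_ball (T : topologicalType) (d : T -> T -> R) x r :
  compatible_metric T d -> 0 < r -> nbhs x [set y | d x y < r].
Proof.
move=> dm r0; apply: open_nbhs_nbhs; split; first exact: open_metric_ball.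
by case: dm => _ dE _ _ _ /=; have -> : d x x = 0 by apply/dE.
Qed.

Lemma invS_lt (r : R) : 0 < r -> exists n : nat, n.+1%:R^-1 < r.
Proof. by move=> /ltr_add_invr[n]; rewrite add0r; exists n. Qed.

(** Indices are pairs because the bases built here are families of balls: one number codes the
    centre, the other the radius. *)
Definition countable_base (T : topologicalType) (B : nat * nat -> set T) : Prop :=
  (forall n, open (B n)) /\
  (forall x U, nbhs x U -> exists n, B n x /\ B n `<=` U).

Lemma separable_metrizable_base (T : topologicalType) :
  is_separable T -> is_metrizable T -> exists B, countable_base T B.
Proof.
move=> [S [/countable_injP[f finj] dS]] [d dm].
(* As [f] is injective on [S], this union is a single ball, or empty when [nm.1] codes no point of
   [S]. *)
exists (fun nm => \bigcup_(s in [set s | S s /\ f s = nm.1])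
  [set y | d s y < nm.2.+1%:R^-1]); split => [nm|x U].
  by apply: bigcup_open => s _; exact: open_metric_ball.
rewrite nbhsE => -[V [oV Vx] VU].
case: (dm) => _ _ dC dT dO.
have [r r0 rV] := (dO V).1 oV x Vx.
have [m mr] : exists m : nat, m.+1%:R^-1 < r / 2 :> R by apply: invS_lt; lra.
have m0 : 0 < m.+1%:R^-1 :> R by rewrite invr_gt0 ltr0n.
have [s [/= xs Ss]] : [set y | d x y < m.+1%:R^-1] `&` S !=set0.
  apply: dS (open_metric_ball _ _ _ _ dm).
  by exists x; apply: nbhs_singleton; exact: nbhs_metric_ball.
exists (f s, m); split; first by exists s => //=; rewrite dC.
move=> y [t /= [St fts] ty]; apply: VU; apply: rV.
have ts : t = s by apply: finj => //; rewrite inE.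
move: xs ty; rewrite ts => xs sy.
move: (m.+1%:R^-1) mr xs sy => q mr xs sy.
by apply: le_lt_trans (dT x s y) _; lra.
Qed.

(** Compactness gives a finite net at each scale [1/(n+1)]; the union of these nets is dense. *)
Lemma compact_metrizable_separable (T : topologicalType) :
  compact [set: T] -> is_metrizable T -> is_separable T.
Proof.
move=> cT [d dm].
have net n : exists s : seq T, forall y, exists2 x, x \in s & d y x < n.+1%:R^-1.
  apply: contrapT => /forallNP noS.
  (* Without a finite net, the sets of points far from a finite list generate a proper filter. It
     cannot cluster at any [x], since [D [:: x]] misses a ball around [x]. *)
  pose D (s : seq T) := [set y | forall x, x \in s -> n.+1%:R^-1 <= d y x].
  have FD : Filter (filter_from setT D).
    apply: filter_from_filter; first by exists [::].
    move=> s t _ _; exists (s ++ t) => // y Dy; split => x xs; apply: Dy;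
    by rewrite mem_cat xs ?orbT.
  have PFD : ProperFilter (filter_from setT D).
    apply: filter_from_proper => s _.
    have [y Hy] := (existsNP _).2 (noS s); exists y => x xs.
    by rewrite leNgt; apply/negP => lt; apply: Hy; exists x.
  have [x [_ clx]] := cT _ PFD (filterT).
  have Dx : filter_from setT D (D [:: x]) by exists [:: x].
  have bx : nbhs x [set y | d x y < n.+1%:R^-1].
    by apply: nbhs_metric_ball => //; rewrite invr_gt0 ltr0n.
  have [y [/= Dy xy]] := clx _ _ Dx bx.
  have := Dy x (mem_head _ _); case: (dm) => _ _ -> _ _.
  by rewrite leNgt xy.
have [s sP] := choice net.
exists (\bigcup_n [set` s n]); split.
  by apply: bigcup_countable => // n _; exact: finite_set_countable.
move=> O [x Ox] oO; case: (dm) => _ _ _ _ dO.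
have [r r0 rO] := (dO O).1 oO x Ox.
have [n nr] := invS_lt _ r0; have [y ys yx] := sP n x.
by exists y; split; [apply: rO; exact: lt_trans nr | exists n].
Qed.

Lemma Cp_countable_network (X G : topologicalType) K V :
  countable_base X K -> countable_base G V -> has_countable_network (@Cp X G).
Proof.
move=> [oK Kb] [oV Vb].
pose B (s : seq ((nat * nat) * (nat * nat))) : set {ptws X -> G} :=
  @Cp X G `&` [set f : {ptws X -> G} |
     forall p, p \in s -> forall x, K p.1 x -> V p.2 (f x)].
exists (range B); split.
- exact: sub_countable (card_image_le _ _) (countableP _).
- by move=> _ [s _ <-] f [].
move=> f U cf oU Uf.
(* The network members containing [f] are closed under intersection and form a filter base.
   Pointwise convergence of that filter to [f] puts one of them inside [U], with no need to unfold
   basic open sets of the product. *)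
pose F : set_system {ptws X -> G} := filter_from [set s | B s f] B.
have FF : Filter F.
  apply: filter_from_filter; first by exists [::]; split.
  move=> s t [_ Bs] [_ Bt]; exists (s ++ t).
    by split=> // p; rewrite mem_cat => /orP[]; [exact: Bs | exact: Bt].
  move=> g [cg Bg]; split; split=> // p ps; apply: Bg;
  by rewrite mem_cat ps ?orbT.
have Ff : F --> f.
  apply: cvg_ptws => x W /Vb[j [Vfx jW]].
  have /Kb[i [Kx iK]] : nbhs x (f @^-1` V j).
    by apply: cf; apply: open_nbhs_nbhs.
  exists [:: (i, j)].
    by split=> // p; rewrite inE => /eqP -> /= y Ky; exact: iK.
  by move=> g [_ Bg]; apply: jW; exact: (Bg (i, j) (mem_head _ _)).
have [s sf sU] : F U by apply: Ff; exact: open_nbhs_nbhs.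
by exists (B s); [exists s | split=> // g Bg; split; [exact: sU | case: Bg]].
Qed.

(** * Powers and partial products in a topological group *)

Lemma partial_prod_eval (X G : topologicalType) mul inv (e : G)
    (a : nat -> {ptws X -> G}) z k x :
  partial_prod (@pw_mul X G mul) (@pw_inv X G inv) (@pw_unit X G e) a z k x =
  partial_prod mul inv e (fun n => a n x) z k.
Proof.
have powE n w : gpow (@pw_mul X G mul) (@pw_inv X G inv) (@pw_unit X G e)
    (a n) w x = gpow mul inv e (a n x) w.
  by case: w => m /=; [|congr (mul _ _)]; elim: m => //= m <-.
by elim: k => [|k IH] /=; rewrite ?powE // -IH -powE.
Qed.

Lemma topological_groupK (G : topologicalType) mul inv (e : G) :
  is_topological_group mul inv e ->
  (forall x y, mul (inv x) (mul x y) = y) /\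
  (forall x y, mul x (mul (inv x) y) = y).
Proof.
move=> [[mA m1 mV] _]; split=> x y.
  by rewrite mA (mV x).1 (m1 y).1.
by rewrite mA (mV x).2 (m1 y).1.
Qed.

Lemma gpow_add (G : topologicalType) mul inv (e g : G) :
  is_topological_group mul inv e ->
  forall a b, gpow mul inv e g (a + b) =
              mul (gpow mul inv e g a) (gpow mul inv e g b).
Proof.
move=> tg; have [VK KV] := topological_groupK _ _ _ _ tg.
have [[mA m1 mV] _] := tg.
have powS z : gpow mul inv e g (1 + z) = mul g (gpow mul inv e g z).
  case: z => [n|[|n]] //.
    by rewrite /= (m1 (inv g)).2 (mV g).2.
  have -> : 1 + Negz n.+1 = Negz n by rewrite !NegzE; lra.
  by rewrite /= KV.
have powV z : gpow mul inv e g (-1 + z) = mul (inv g) (gpow mul inv e g z).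
  by have := powS (-1 + z); rewrite addrA subrr add0r => ->; rewrite VK.
move=> a b; elim: a => [|n IH|n IH].
- by rewrite add0r (m1 _).1.
- by rewrite intS -addrA !powS IH mA.
- by rewrite intS opprD -addrA !powV IH mA.
Qed.

Lemma gpow_subgroup (G : topologicalType) mul inv (e g : G) :
  is_topological_group mul inv e ->
  is_subgroup mul inv e (range (gpow mul inv e g)).
Proof.
move=> tg; have [VK KV] := topological_groupK _ _ _ _ tg.
have powD := gpow_add _ _ _ _ g tg; have [[mA m1 mV] _] := tg.
split; first by exists 0.
- by move=> _ _ [a _ <-] [b _ <-]; exists (a + b).
- move=> _ [a _ <-]; exists (- a) => //.
  by rewrite -[LHS](VK (gpow mul inv e g a)) -powD subrr /= (m1 _).2.
Qed.

(** Otherwise the cyclic subgroup generated by [g] would lie in [U], hence be trivial. *)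
Lemma NSS_power (G : topologicalType) mul inv (e : G) (U : set G) :
  is_topological_group mul inv e ->
  (forall S, is_subgroup mul inv e S -> S `<=` U -> S = [set e]) ->
  forall g, g <> e -> exists z, ~ U (gpow mul inv e g z).
Proof.
move=> tg nss g ge; apply: contrapT => /forallNP h.
have se := nss _ (gpow_subgroup _ _ _ _ g tg).
have : range (gpow mul inv e g) (gpow mul inv e g 1) by exists 1.
rewrite se => [/=|_ [z _ <-]]; last by apply: contrapT; exact: h.
by have [[_ m1 _] _] := tg; rewrite (m1 g).2.
Qed.

(** A Cauchy argument: choose [z n] so that the power of [a n] leaves [U] whenever [a n <> e].
    Quotients of consecutive partial products tend to [e], so these powers are eventually in [U]. *)
Lemma productive_eventually_trivial (G : topologicalType) mul inv (e : G)
    (a : nat -> G) :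
  is_topological_group mul inv e -> NSS mul inv e ->
  (forall z, exists l : G, partial_prod mul inv e a z @ \oo --> l) ->
  exists N : nat, forall n : nat, (N <= n)%N -> a n = e.
Proof.
move=> tg [U [oU Ue nss]] pr.
have [VK KV] := topological_groupK _ _ _ _ tg.
have [[mA m1 mV] [mc ic hG]] := tg.
have /choice[z zP] : forall n, exists z, a n <> e -> ~ U (gpow mul inv e (a n) z).
  move=> n; have [->|ne] := pselect (a n = e); first by exists 0.
  by have [z ?] := NSS_power _ _ _ _ _ tg nss _ ne; exists z.
have [l Pl] := pr z; pose P := partial_prod mul inv e a z.
have Pl1 : (fun n => P n.+1) @ \oo --> l.
  apply: (cvg_comp S P _ Pl) => A [N _ NA].
  by exists N => // n /= Nn; apply: NA; exact: leqW.
have Pi : (fun n => inv (P n)) @ \oo --> inv l.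
  exact: (cvg_comp _ _ Pl (ic l)).
have : (fun n => mul (inv (P n)) (P n.+1)) @ \oo --> mul (inv l) l.
  apply: (@continuous2_cvg nat G G G \oo _ _ _ mul) => //.
  exact: (mc (inv l, l)).
rewrite (mV l).1 => /(_ U) /(_ _)[]; first exact: open_nbhs_nbhs.
(* The shift by one arises because the quotient with index [n] is the power of [a n.+1]. *)
move=> N _ NP; exists N.+1 => -[//|n] Nn; apply: contrapT => /zP; apply.
by have := NP n Nn; rewrite /= VK.
Qed.

Lemma infinite_set_injection (T : Type) (A : set T) : infinite_set A ->
  exists2 a : nat -> T, injective a & forall n, A (a n).
Proof.
move=> /infiniteP/card_leP/injfunPex[f _ finj].
exists (fun n => val (f (to_setT n))) => [m n /val_inj fmn|n]; last exact: set_valP.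
have /(congr1 val) : to_setT m = to_setT n by apply: finj => //; rewrite inE.
by [].
Qed.

Lemma cvg_partial_prod_eval (X G : topologicalType) mul inv (e : G)
    (a : nat -> {ptws X -> G}) z (l : {ptws X -> G}) x :
  partial_prod (@pw_mul X G mul) (@pw_inv X G inv) (@pw_unit X G e) a z
    @ \oo --> l ->
  partial_prod mul inv e (fun n => a n x) z @ \oo --> l x.
Proof.
move=> Pl; have := cvg_comp _ _ Pl (ptws_eval_cvg l x).
by under eq_cvg do rewrite /= partial_prod_eval.
Qed.

Lemma gpow1 (G : topologicalType) mul inv (e : G) z :
  is_topological_group mul inv e -> gpow mul inv e e z = e.
Proof.
move=> [[_ m1 mV] _].
have ie : inv e = e by rewrite -[LHS](m1 _).2 (mV e).1.
have it n : iter n (mul e) e = e by elim: n => //= n ->; rewrite (m1 e).1.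
by case: z => n; [|rewrite /gpow ie]; exact: it.
Qed.

Lemma partial_prod_stationary (G : topologicalType) mul inv (e : G) a z N :
  is_topological_group mul inv e ->
  (forall n, (N < n)%N -> a n = e) ->
  forall n, (N <= n)%N ->
    partial_prod mul inv e a z n = partial_prod mul inv e a z N.
Proof.
move=> tg ae n /subnKC <-; elim: (n - N)%N => [|k IH]; first by rewrite addn0.
rewrite addnS /= IH ae ?ltnS ?leq_addr// gpow1//.
by have [[_ m1 _] _] := tg; rewrite (m1 _).2.
Qed.

(** * The TAP property over a compact space *)

Lemma compact_Cp_TAP (G X : topologicalType) mul inv (e : G) :
  is_topological_group mul inv e -> NSS mul inv e -> compact [set: X] ->
  is_TAP (@pw_mul X G mul) (@pw_inv X G inv) (@pw_unit X G e) (@Cp X G).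
Proof.
move=> tg nss cX A AC Ap; apply: contrapT => infA.
(* The unit is removed from [A] so that every [a n] is nontrivial at some point. *)
have [a ainj aA] := infinite_set_injection _ _
  (infinite_setD infA (finite_set1 (@pw_unit X G e))).
have [[mA m1 mV] [mc ic hG]] := tg.
have [VK KV] := topological_groupK _ _ _ _ tg.
have pf x : exists N : nat, forall n : nat, (N <= n)%N -> a n x = e.
  apply: productive_eventually_trivial tg nss _ => z.
  have [l _ Pl] := Ap a z ainj (fun n => (aA n).1).
  by exists (l x); exact: cvg_partial_prod_eval Pl.
have /choice[x xP] n : exists x, a n x <> e.
  by apply/existsNP => ae; apply: (aA n).2; apply/funext.
have /choice[M MP] n : exists N : nat, forall m : nat, (N <= m)%N -> a m (x n) = e.
  exact: pf.
(* Each new index exceeds the previous index [k] and also [M k], beyond which all functions are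
   trivial at [x k]. *)
pose phi i := iter i (fun k => (maxn k (M k)).+1) 0%N.
have phi_lt i j : (i < j)%N -> (phi i < phi j)%N && (M (phi i) <= phi j)%N.
  elim: j => // j IH; rewrite ltnS leq_eqVlt => /predU1P[->|/IH /andP[lt le]] /=.
    by rewrite ltnS leq_maxl leqW// leq_maxr.
  rewrite ltnS !leq_max (ltnW lt)/=; apply: leqW.
  by rewrite leq_max le.
have phi_ge i : (i <= phi i)%N.
  by elim: i => // i IH; rewrite /= ltnS leq_max IH.
have phi_inj : injective phi.
  move=> i j ij; case: (ltngtP i j) => // /phi_lt; by rewrite ij ltnn.
have [p [_ clp]] : [set: X] `&` cluster ((x \o phi) @ \oo) !=set0.
  by apply: cX; exact: filterT.
have [K KP] := pf p.
(* Since [i <= phi i], dropping the first [K] terms makes every remaining function trivial at the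
   cluster point [p]. *)
pose c i := a (phi (i + K)%N); pose w i := x (phi (i + K)%N).
have cp i : c i p = e.
  by apply: KP; apply: leq_trans (phi_ge _); exact: leq_addl.
have cw i j : (i < j)%N -> c j (w i) = e.
  by move=> ij; apply: MP; have /phi_lt/andP[] : (i + K < j + K)%N by rewrite ltn_add2r.
have [U [oU Ue nssU]] := nss.
(* If [g] and its product with a further factor both lie in [W], that factor lies in [U]; so a power
   outside [U] must push the product out of [W]. *)
have [W [nW WU]] : exists W : set G, nbhs e W /\
    forall g h, W g -> W h -> U (mul (inv g) h).
  have : (fun q : G * G => mul (inv q.1) q.2) @ (e, e) --> mul (inv e) e.
    apply: (@continuous2_cvg _ G G G _ _ _ _ mul).
    - exact: (mc (inv e, e)).
    - by apply: (cvg_comp _ _ cvg_fst); exact: ic.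
    - exact: cvg_snd.
  rewrite (mV e).1 => /(_ U (open_nbhs_nbhs (conj oU Ue))) [[W1 W2] /= [n1 n2] h].
  exists (W1 `&` W2); split; first exact: filterI.
  by move=> g k [g1 _] [_ k2]; apply: (h (g, k)).
(* Given the value [gn.1] of the product so far at the point [w gn.2], some
   exponent drives it out of [W]. *)
have /choice[zt ztP] (gn : G * nat) : exists z,
    ~ W (mul gn.1 (gpow mul inv e (c gn.2 (w gn.2)) z)).
  have [Wg|nWg] := pselect (W gn.1); last first.
    by exists 0; rewrite /= (m1 _).2.
  have [z zP] := NSS_power _ _ _ _ _ tg nssU _ (xP (phi (gn.2 + K)%N)).
  by exists z => Wgz; apply: zP; rewrite -[gpow _ _ _ _ _](VK gn.1); exact: WU.
(* [Q n] is the product of the first [n] factors, one fewer than in [partial_prod] at [n]. The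
   recursion carries whole functions because the exponent of factor [m] is read off at [w m], a
   point that changes with [m]. *)
pose Q := fix Q n : X -> G := if n is m.+1 then
  fun y => mul (Q m y) (gpow mul inv e (c m y) (zt (Q m (w m), m))) else fun=> e.
pose z m := zt (Q m (w m), m).
have QE y n : partial_prod mul inv e (fun n => c n y) z n = Q n.+1 y.
  by elim: n => [|n IH]; [rewrite /= (m1 _).1 | rewrite [LHS]/= IH].
have cinj : injective c.
  by move=> i j /ainj/phi_inj/addIn.
have [l Cl Pl] := Ap c z cinj (fun n => (aA _).1).
have lE y N : (forall n, (N < n)%N -> c n y = e) -> l y = Q N.+1 y.
  move=> ce; apply: (cvg_unique hG (cvg_partial_prod_eval _ _ _ _ _ _ _ _ y Pl)).
  apply: cvg_near_cst; exists N => // n /= Nn.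
  by rewrite (partial_prod_stationary _ _ _ _ _ _ _ tg ce) ?QE.
have lp : l p = e.
  by rewrite (lE p 0%N) ?cp//= cp gpow1// (m1 e).1.
(* Factors after the [n]-th are trivial at [w n], so the limit there is the value that the [n]-th
   exponent placed outside [W]. *)
have lW n : ~ W (l (w n)).
  by rewrite (lE _ n (cw n)); exact: ztP (Q n (w n), n).
have nlW : nbhs p ((l : X -> G) @^-1` W) by apply: Cl; rewrite lp.
have nw : ((x \o phi) @ \oo) [set y | exists n, y = w n].
  by exists K => // n /= Kn; exists (n - K)%N; rewrite /w subnK.
by have [_ [[n ->] /lW]] := clp _ _ nw nlW.
Qed.

(** * Products of locally finite families of functions *)

Lemma continuous_partial_prod (X G : topologicalType) mul inv (e : G)
    (a : nat -> X -> G) z k :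
  is_topological_group mul inv e -> (forall n, continuous (a n)) ->
  continuous (fun x => partial_prod mul inv e (fun n => a n x) z k).
Proof.
move=> [_ [mc ic _]] ac.
have mulc (f g : X -> G) : continuous f -> continuous g ->
    continuous (fun x => mul (f x) (g x)).
  move=> fc gc x; apply: (@continuous2_cvg _ G G G _ _ _ _ mul).
  - exact: (mc (f x, g x)).
  - exact: fc.
  - exact: gc.
have iterc (f : X -> G) n : continuous f ->
    continuous (fun x => iter n (mul (f x)) e).
  move=> fc; elim: n => [|n IH] /=; first by move=> x; exact: cvg_cst.
  exact: mulc.
have powc n w : continuous (fun x => gpow mul inv e (a n x) w).
  case: w => m; first exact: iterc.
  apply: (iterc (fun x => inv (a n x))) => x.
  exact: (cvg_comp _ _ (ac n x) (ic (a n x))).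
elim: k => [|k IH] /=; first exact: powc.
by apply: mulc.
Qed.

(** Local finiteness of the supports, as a bound on the index that is uniform over a
    neighbourhood. *)
Definition locally_finitely_supported (X G : topologicalType) (e : G)
    (f : nat -> X -> G) : Prop :=
  forall x : X, exists2 V, nbhs x V &
    exists N : nat, forall n y, (N <= n)%N -> V y -> f n y = e.

(** An injection takes values below [N] only finitely often. This is needed because absolute
    productivity ranges over all injective sequences in the set. *)
Lemma locally_finitely_supported_comp (X G : topologicalType) (e : G)
    (f : nat -> X -> G) (phi : nat -> nat) :
  injective phi -> locally_finitely_supported X G e f ->
  locally_finitely_supported X G e (f \o phi).
Proof.
move=> phi_inj lf x; have [V nV [N NP]] := lf x; exists V => //.
suff [N' N'P] : exists N' : nat, forall n, (N' <= n)%N -> (N <= phi n)%N.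
  by exists N' => n y Nn; apply: NP; exact: N'P.
elim: N {NP} => [|N [N' IH]]; first by exists 0%N.
have [[m mN]|nm] := pselect (exists m, phi m = N).
  exists (maxn N' m.+1) => n; rewrite geq_max => /andP[/IH N'n mn].
  rewrite ltn_neqAle N'n andbT; apply/eqP => Nn.
  by move: mn; rewrite (phi_inj m n) ?ltnn// mN.
exists N' => n /IH N'n; rewrite ltn_neqAle N'n andbT.
by apply/eqP => Nn; apply: nm; exists n.
Qed.

(** Near each point the infinite product is a finite one, whatever the exponents. *)
Lemma locally_finite_productive (X G : topologicalType) mul inv (e : G)
    (f : nat -> {ptws X -> G}) :
  is_topological_group mul inv e -> (forall n, @Cp X G (f n)) ->
  locally_finitely_supported X G e f ->
  absolutely_productive (@pw_mul X G mul) (@pw_inv X G inv) (@pw_unit X G e)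
    (@Cp X G) (range f).
Proof.
move=> tg fC lf a z ainj fa.
have fa' n : exists m, f m = a n by have [m _ <-] := fa n; exists m.
have [phi phiP] := choice fa'.
have phi_inj : injective phi by move=> i j ij; apply: ainj; rewrite -!phiP ij.
have alf : locally_finitely_supported X G e a.
  have -> : a = f \o phi by apply/funext => n; rewrite /= phiP.
  exact: locally_finitely_supported_comp.
have alf' (x : X) : exists N : nat, exists2 V, nbhs x V &
    forall n y, (N < n)%N -> V y -> a n y = e.
  have [V nV [N NP]] := alf x; exists N; exists V => // n y /ltnW; exact: NP.
have [N NP] := choice alf'.
pose P := partial_prod mul inv e.
pose l : {ptws X -> G} := fun x => P (fun n => a n x) z (N x).
(* The cutoff [N y] may vary with [y], but on [V] both [N x] and [N y] are valid cutoffs at [y].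
   Hence [l] is locally a partial product of fixed length, and so continuous. *)
have lP x : exists2 V, nbhs x V & forall y, V y -> l y = P (fun n => a n y) z (N x).
  have [V nV VP] := NP x; exists V => // y Vy; have [V' nV' VP'] := NP y.
  rewrite /l; case: (leqP (N x) (N y)) => [le|/ltnW le].
    by apply: partial_prod_stationary => // n Nn; exact: VP.
  apply/esym; apply: partial_prod_stationary => // n Nn.
  by apply: VP' => //; exact: nbhs_singleton.
exists l.
  move=> x U; have [V nV VP] := lP x; rewrite (VP x (nbhs_singleton nV)) => nU.
  have ac n : continuous (a n : X -> G) by rewrite -phiP; exact: fC.
  have := continuous_partial_prod _ _ _ _ _ a z (N x) tg ac x U nU.
  move=> nU'; apply: filterS (filterI nV nU') => y [Vy Uy].
  by rewrite /= VP.
apply: cvg_ptws => x.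
apply: cvg_near_cst; exists (N x) => // n /= Nn.
rewrite partial_prod_eval; apply: partial_prod_stationary => // m Nm.
by have [V nV VP] := NP x; apply: VP => //; exact: nbhs_singleton.
Qed.

(** A nontrivial function can occur only finitely often in the sequence, so a finite range would
    make the index set finite. *)
Lemma locally_finite_infinite (X G : topologicalType) (e : G)
    (f : nat -> {ptws X -> G}) :
  locally_finitely_supported X G e f -> (forall n, f n <> @pw_unit X G e) ->
  infinite_set (range f).
Proof.
move=> lf fe fin; apply: infinite_nat.
have -> : [set: nat] = \bigcup_(g in range f) (f @^-1` [set g]).
  by apply/seteqP; split=> // n _; exists (f n).
apply: bigcup_finite => // g [m _ <-].
have [x fx] : exists x, f m x <> e.
  by apply/existsNP => h; apply: (fe m); apply/funext.
have [V nV [N NP]] := lf x.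
apply: (sub_finite_set _ (finite_II N)) => n /= nm.
rewrite ltnNge; apply/negP => /NP/(_ (nbhs_singleton nV)).
by rewrite nm.
Qed.

(** * From a network of the function space to the base space *)

Lemma Cp_network_base_space (X G : topologicalType) (e : G) B :
  hausdorff_space G -> countable_base G B -> G_regular e X ->
  has_countable_network (@Cp X G) -> has_countable_network [set: X].
Proof.
move=> hG [oB Bb] reg [N [cN NC NP]].
(* Take [f] trivial off [U] and a basic set [B j] around [f x] that misses [e]. If the network
   member [A] contains [f] and all its functions send [x] into [B j], then [M (A, j)] contains [x]
   and lies where [f] is nontrivial, hence in [U]. *)
pose M (p : set {ptws X -> G} * (nat * nat)) : set X :=
  [set y | forall f, p.1 f -> B p.2 (f y)].
exists (M @` (N `*` setT)); split=> //.
  by apply: sub_countable (card_image_le _ _) _; exact: countableX.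
move=> x U _ oU Ux.
have [||f [g [cf ge fx fU]]] := reg (~` U) x; first exact: open_closedC.
  by move=> /(_ Ux).
have [j [Bg Be]] : exists j, B j g /\ B j `<=` ~` [set e].
  apply: Bb; apply: open_nbhs_nbhs; split; last exact: ge.
  apply: closed_openC; apply: accessible_closed_set1.
  exact: hausdorff_accessible.
have oj : open [set h : {ptws X -> G} | B j (h x)].
  apply: (@open_comp _ _ (fun h : {ptws X -> G} => h x) (B j) _ (oB j)) => h _.
  exact: ptws_eval_cvg.
have [|A NA [Af AB]] := NP f _ cf oj; first by rewrite /= fx.
exists (M (A, j)); first by exists (A, j).
split=> [h /AB[]//|y My]; split=> //; apply: contrapT => /fU fy.
by apply: (Be _ (My f Af)); rewrite fy.
Qed.

(** * Metrizability from countably many separating maps *)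

Lemma min_triangle (a b c s : R) : 0 <= a -> 0 <= b -> 0 <= c -> s <= b + c ->
  Num.min a s <= Num.min a b + Num.min a c.
Proof.
move=> a0 b0 c0 sbc; rewrite ge_min.
case: (lerP a b) => ab; case: (lerP a c) => ac; apply/orP;
  [left|left|left|right]; lra.
Qed.

Lemma compact_separated_metrizable (X G : topologicalType)
    (rho : G -> G -> R) (h : nat -> X -> G) :
  compatible_metric G rho -> compact [set: X] ->
  (forall n, continuous (h n)) ->
  (forall x y, x <> y -> exists n, h n x <> h n y) ->
  is_metrizable X.
Proof.
move=> rm cX hc hs; have [r0 rE rC rT rO] := rm.
pose q n : R := n.+1%:R^-1.
have q0 n : 0 < q n by rewrite invr_gt0 ltr0n.
pose t x y n := Num.min (q n) (rho (h n x) (h n y)).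
have tge0 x y n : 0 <= t x y n by rewrite le_min (ltW (q0 n)) r0.
have tle x y n : t x y n <= q n by rewrite ge_min lexx.
have tle1 x y n : t x y n <= 1.
  by apply: le_trans (tle x y n) _; rewrite invf_le1// ler1n.
pose d x y := sup (range (t x y)).
have td x y n : t x y n <= d x y.
  by apply: ub_le_sup; [exists 1 => _ [m _ <-] | exists n].
have dle x y c : (forall n, t x y n <= c) -> d x y <= c.
  by move=> tc; apply: ge_sup; [exists (t x y 0%N); exists 0%N | move=> _ [n _ <-]].
have d0 x y : 0 <= d x y by exact: le_trans (tge0 x y 0%N) (td x y 0%N).
(* Below [q n] the truncation is inactive, so [d] controls the [n]-th coordinate itself. *)
have rho_lt x y n r : d x y < Num.min (q n) r -> rho (h n x) (h n y) < r.
  move=> dqr; have := le_lt_trans (td x y n) dqr.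
  by rewrite lt_min !gt_min ltxx /= => /andP[h1 /orP[h2|//]]; lra.
exists d; split => //.
- move=> x y; split=> [dxy|->].
    apply: contrapT => /hs[n]; apply; apply/rE/eqP; rewrite eq_le r0 andbT.
    rewrite leNgt; apply/negP => rpos.
    suff : rho (h n x) (h n y) < rho (h n x) (h n y) by rewrite ltxx.
    by apply: rho_lt; rewrite dxy lt_min q0.
  apply/eqP; rewrite eq_le d0 andbT; apply: dle => n.
  by rewrite /t ge_min (rE _ _).2 ?lexx ?orbT.
- by move=> x y; rewrite /d /t; under eq_fun do rewrite rC.
- move=> x y z; apply: dle => n.
  apply: le_trans (lerD (td x y n) (td y z n)).
  exact: min_triangle (ltW (q0 n)) (r0 _ _) (r0 _ _) (rT _ _ _).
move=> U; split=> [oU x Ux|Ud].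
  apply: contrapT => /forall2NP noeps.
  (* The points outside [U] at small [d]-distance from [x] would cluster at some [y]. Openness of
     [U] forces [y] outside [U], so some [h n] separates [x] from [y], against continuity of [h n]
     at [y]. *)
  pose D (eps : R) := [set y | d x y < eps /\ ~ U y].
  have PF : ProperFilter (filter_from [set eps : R | 0 < eps] D).
    apply: filter_from_proper => [|eps /= eps0].
      apply: filter_from_filter; first by exists 1 => /=.
      move=> i j /= i0 j0; exists (Num.min i j) => /=; first by rewrite lt_min i0.
      by move=> y [/=]; rewrite lt_min => /andP[].
    have [//|/existsNP[y /not_implyP[yx yU]]] := noeps eps.
    by exists y.
  have [y [_ cly]] := cX _ PF filterT.
  have FD eps : 0 < eps -> filter_from [set eps : R | 0 < eps] D (D eps).
    by move=> eps0; exists eps.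
  have [Uy|nUy] := pselect (U y).
    have nU : nbhs y U by exact: open_nbhs_nbhs.
    by have [w [[_ ]]] := cly _ _ (FD _ ltr01) nU.
  have [|n] := hs x y; first by move=> xy; apply: nUy; rewrite -xy.
  apply; apply/rE/eqP; rewrite eq_le r0 andbT leNgt; apply/negP => rpos.
  set r := rho _ _ in rpos; have r20 : 0 < r / 2 by lra.
  have ny : nbhs y (h n @^-1` [set g | rho (h n y) g < r / 2]).
    exact: (hc n y _ (nbhs_metric_ball _ _ (h n y) _ rm r20)).
  have [|w [[/rho_lt xw _] /= yw]] := cly _ _ (FD (Num.min (q n) (r / 2)) _) ny.
    by rewrite lt_min q0.
  have := rT (h n x) (h n w) (h n y); rewrite (rC (h n w)) -/r; lra.
rewrite openE => x /Ud[eps eps0 epsU].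
(* Coordinates from [N] on are already truncated below [eps / 2], so only finitely many continuity
   conditions remain. Halving [eps] keeps the inequality strict after taking the supremum. *)
have [N NP] : exists N : nat, q N < eps / 2 by apply: invS_lt; lra.
suff : nbhs x [set y | forall n, (n < N)%N -> rho (h n x) (h n y) < eps / 2].
  apply: filterS => y yN; apply: epsU; apply: (@le_lt_trans _ _ (eps / 2)); last by lra.
  apply: dle => n; rewrite /t ge_min; case: (ltnP n N) => nN.
    by rewrite (ltW (yN _ nN)) orbT.
  apply/orP; left; apply: le_trans (ltW NP).
  by rewrite lef_pV2 ?posrE ?ltr0n// ler_nat.
elim: {NP} N => [|N IH]; first by apply: filterE.
have eps20 : 0 < eps / 2 by lra.
have nN := hc N x _ (nbhs_metric_ball _ _ (h N x) _ rm eps20).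
apply: filterS (filterI IH nN) => y [yN1 yN] n; rewrite ltnS leq_eqVlt.
by move=> /predU1P[->|]; [exact: yN | exact: yN1].
Qed.

(** * Compactness of the base space *)

(** A filter without cluster points makes [X] a union of open sets whose closures have complements
    in the filter. The network extracts a countable subcover, and removing its closures one after
    another leaves nonempty open sets. *)
Lemma noncompact_locally_finite (X : topologicalType) :
  regular_space X -> has_countable_network [set: X] -> ~ compact [set: X] ->
  exists W : nat -> set X, (forall n, open (W n) /\ W n !=set0) /\
    (forall x : X, exists2 V, nbhs x V &
       exists N : nat, forall n y, (N <= n)%N -> V y -> ~ W n y).
Proof.
move=> rX [N [/countable_injP[c cinj] _ NP]] nc.
have [F [PF noclF]] : exists F : set_system X, ProperFilter F /\
    forall x, ~ cluster F x.
  apply: contrapT => /forallNP h; apply: nc => F PF _.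
  apply: contrapT => /forallNP h'; apply: (h F); split=> // x clx.
  by apply: (h' x).
pose good V := open V /\ F (~` closure V).
have goodx x : exists2 V, V x & good V.
  have [A [B [FA nB AB]]] : exists A B : set X,
      [/\ F A, nbhs x B & ~ (A `&` B !=set0)].
    apply: contrapT => h; apply: (noclF x) => A B FA nB.
    by apply: contrapT => AB; apply: h; exists A, B.
  have [V nV VB] := rX x B nB.
  exists V°; first exact: nV.
  split; first exact: open_interior.
  apply: filterS FA => y Ay /(closure_subset (@interior_subset _ V)) /VB By.
  by apply: AB; exists y.
(* Lindelöf argument: for each code, keep one good set around the coded network member. The empty
   set, itself good, is the default when there is none. *)
have Vi i : exists V, good V /\
    forall A V', N A -> c A = i -> good V' -> A `<=` V' -> A `<=` V.
  have [[A [V [NA cA gV AV]]]|no] := pselect (exists A V,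
      [/\ N A, c A = i, good V & A `<=` V]).
    exists V; split=> // A' V' NA' cA' _ _.
    by have -> : A' = A by apply: cinj; rewrite ?inE// cA.
  exists set0; split.
    by split; [exact: open0 | rewrite closure0 setC0; exact: filterT].
  by move=> A V' NA cA gV' AV'; exfalso; apply: no; exists A, V'.
have [V VP] := choice Vi.
pose W := fix W n : set X :=
  if n is m.+1 then W m `&` ~` closure (V m) else setT.
have WP n : open (W n) /\ F (W n).
  elim: n => [|n [oW FW]] /=; first by split; [exact: openT | exact: filterT].
  have [[_ FV] _] := VP n; split; last exact: filterI.
  by apply: openI => //; apply: closed_openC; exact: closed_closure.
exists W; split=> [n|x].
  by have [oW FW] := WP n; split=> //; exact: filter_ex FW.
have [V' V'x gV'] := goodx x.
have [A NA [Ax AV']] := NP x V' I gV'.1 V'x.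
have AV : A `<=` V (c A).
  by have [_] := VP (c A); apply; [exact: NA | by [] | exact: gV' | move=> y /AV'[]].
have [[oV _] _] := VP (c A).
exists (V (c A)); first by apply: open_nbhs_nbhs; split=> //; exact: AV.
(* The sets [W n] decrease, and the closure of [V (c A)] is removed exactly at stage [(c A).+1]. *)
exists (c A).+1 => n y; elim: n => // n IH; rewrite leq_eqVlt => /predU1P[[<-]|].
  by move=> Vy [_]; apply; exact: subset_closure.
by move=> An Vy [Wy _]; exact: IH Wy.
Qed.

Lemma Cp_TAP_network_compact (X G : topologicalType) mul inv (e : G) :
  is_topological_group mul inv e -> regular_space X -> G_regular e X ->
  is_TAP (@pw_mul X G mul) (@pw_inv X G inv) (@pw_unit X G e) (@Cp X G) ->
  has_countable_network [set: X] -> compact [set: X].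
Proof.
move=> tg rX reg tap net; apply: contrapT => nc.
have [W [WP lfW]] := noncompact_locally_finite _ rX net nc.
have fP n : exists f : {ptws X -> G},
    [/\ @Cp X G f, f <> @pw_unit X G e & forall y, ~ W n y -> f y = e].
  have [oW [x Wx]] := WP n.
  have [||f [g [cf ge fx fW]]] := reg (~` W n) x; first exact: open_closedC.
    by move=> /(_ Wx).
  by exists f; split=> // fe; apply: ge; rewrite -fx fe.
have [f {}fP] := choice fP.
have lf : locally_finitely_supported X G e f.
  move=> x; have [V nV [N NP]] := lfW x; exists V => //; exists N => n y Nn Vy.
  by have [_ _] := fP n; apply; exact: NP Vy.
have fne n : f n <> @pw_unit X G e by have [] := fP n.
have fC n : @Cp X G (f n) by have [] := fP n.
apply: (locally_finite_infinite _ _ _ _ lf fne); apply: tap.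
  by move=> _ [n _ <-].
exact: locally_finite_productive.
Qed.

(** One function picked from each nonempty network member suffices: separating [x] and [y] by values
    in two disjoint open sets is an open condition, so some network member consists entirely of
    functions doing so. *)
Lemma Cp_network_separating (X G : topologicalType) (e : G) :
  hausdorff_space G -> hausdorff_space X -> G_regular e X ->
  has_countable_network (@Cp X G) ->
  exists h : nat -> X -> G, (forall n, continuous (h n)) /\
    (forall x y, x <> y -> exists n, h n x <> h n y).
Proof.
move=> hG hX reg [N [/countable_injP[c cinj] NC NP]].
have hP n : exists f : X -> G, continuous f /\
    forall A, N A -> A !=set0 -> c A = n -> A f.
  have [[A [NA [f Af] cA]]|no] := pselect (exists A, [/\ N A, A !=set0 & c A = n]).
    exists f; split; first exact: (NC A NA f Af).
    by move=> A' NA' _ cA'; have -> : A' = A by apply: cinj; rewrite ?inE// cA.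
  (* A constant map serves for numbers that code no nonempty network member. *)
  exists (fun=> e); split; first by move=> x; exact: cvg_cst.
  by move=> A NA A0 cA; exfalso; apply: no; exists A.
have [h {}hP] := choice hP.
exists h; split=> [n|x y xy]; first by have [] := hP n.
have [||f [g [cf ge fx fy]]] := reg [set y] x.
- by apply: accessible_closed_set1; exact: hausdorff_accessible.
- by move/xy.
move: hG; rewrite open_hausdorff => /(_ (f x) (f y)).
rewrite fx (fy y)//; case; first exact/eqP.
move=> [A1 A2] /= [/set_mem A1g /set_mem A2e] [oA1 oA2 /eqP A12].
have evo (O : set G) z : open O -> open [set k : {ptws X -> G} | O (k z)].
  move=> oO; apply: (@open_comp _ _ (fun k : {ptws X -> G} => k z) O _ oO) => k _.
  exact: ptws_eval_cvg.
have [|A NA [Af AO]] := NP f _ cf (openI (evo _ x oA1) (evo _ y oA2)).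
  by split=> /=; rewrite ?fx ?(fy y).
exists (c A) => hxy; have [_ hA] := hP (c A).
have [[/= h1 h2] _] := AO _ (hA A NA (ex_intro _ _ Af) erefl).
by have : set0 (h (c A) y) by rewrite -A12; split; rewrite // -hxy.
Qed.

Theorem theorem7p8 (G : topologicalType) (mul : G -> G -> G) (inv : G -> G)
  (e : G) (X : topologicalType) :
  is_topological_group mul inv e ->
  is_separable G -> is_metrizable G -> NSS mul inv e ->
  tychonoff_space X -> G_regular e X ->
  ((compact [set: X] /\ is_metrizable X) <->
   (is_TAP (@pw_mul X G mul) (@pw_inv X G inv) (@pw_unit X G e) (@Cp X G) /\
    has_countable_network (@Cp X G))).
Proof.
move=> tg sG mG nss [crX hX] reg; have [_ [_ _ hG]] := tg.
have [B bB] := separable_metrizable_base _ sG mG.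
split=> [[cX mX]|[tap net]].
  split; first exact: compact_Cp_TAP.
  have [K bK] := separable_metrizable_base _ (compact_metrizable_separable _ cX mX) mX.
  exact: Cp_countable_network bK bB.
have cX : compact [set: X].
  apply: (Cp_TAP_network_compact _ _ _ _ _ tg _ reg tap).
    exact: (@completely_regular_regular R).
  exact: Cp_network_base_space hG bB reg net.
split=> //; have [rho rm] := mG.
have [h [hc hs]] := Cp_network_separating _ _ _ hG hX reg net.
exact: compact_separated_metrizable rm cX hc hs.
Qed.
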